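(* Let $Q$ be a finite, connected, acyclic quiver with vertex set $Q_0$ and let $\alpha_1$ and $\alpha_2$ be two rational vectors in $\mathbb{Q}^{Q_0}$. Then $\alpha_1$ and $\alpha_2$ are GIT-equivalent, i.e. $\mathrm{rep}(Q)^{ss}_{\mathrm{wt}(\alpha_1)}=\mathrm{rep}(Q)^{ss}_{\mathrm{wt}(\alpha_2)}$, if and only if $\mathcal{I}_{\alpha_1}=\mathcal{I}_{\alpha_2}$.
   Context: $K$ is an algebraically closed field of characteristic zero; all representations of $Q=(Q_0,Q_1,t,h)$ (with $ta$, $ha$ the tail and head of an arrow $a$) are finite-dimensional over $K$. A dimension vector is an element of $\mathbb{Z}_{\ge 0}^{Q_0}$. The Euler form is $\langle\alpha,\beta\rangle=\sum_{x\in Q_0}\alpha(x)\beta(x)-\sum_{a\in Q_1}\alpha(ta)\beta(ha)$, a bilinear form on $\mathbb{Q}^{Q_0}$. For $\theta,\beta\in\mathbb{Q}^{Q_0}$ put $\theta(\beta)=\sum_{x\in Q_0}\theta(x)\beta(x)$. For $\alpha\in\mathbb{Q}^{Q_0}$ put $\mathrm{wt}(\alpha)=(\langle\alpha,\mathbf{e}_x\rangle)_{x\in Q_0}$, where $\mathbf{e}_x$ are the standard unit vectors; thus $\mathrm{wt}(\alpha)(\beta)=\langle\alpha,\beta\rangle$. For $\theta\in\mathbb{Q}^{Q_0}$, a representation $V$ is $\theta$-semi-stable if $\theta(\underline{\dim}\,V)=0$ and $\theta(\underline{\dim}\,V')\le 0$ for all subrepresentations $V'\le V$. $\mathrm{rep}(Q)^{ss}_\theta$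 is the full subcategory of $\theta$-semi-stable representations, and $\mathrm{rep}(Q,\beta)^{ss}_\theta$ is the set of $\theta$-semi-stable representations of dimension vector $\beta$. For a dimension vector $\beta$, $\mathcal{D}(\beta)=\{\alpha\in\mathbb{Q}^{Q_0}\mid \text{there exists a }\beta\text{-dimensional }\mathrm{wt}(\alpha)\text{-semi-stable representation}\}$; this is a rational convex polyhedral cone. For $\alpha\in\mathcal{D}(\beta)$, the GIT-cone of $\alpha$ relative to $\beta$ is $\mathcal{C}(\beta)_\alpha=\{\alpha'\in\mathcal{D}(\beta)\mid \mathrm{rep}(Q,\beta)^{ss}_{\mathrm{wt}(\alpha)}\subseteq \mathrm{rep}(Q,\beta)^{ss}_{\mathrm{wt}(\alpha')}\}$, again a rational convex polyhedral cone. A Schur root is a dimension vector $\beta$ for which there is a $\beta$-dimensional representation $V$ with $\mathrm{End}_Q(V)\cong K$. For a Schur root $\beta$, $\mathcal{C}(\beta)$ denotes the collection of GIT-cones $\mathcal{C}(\beta)_\alpha$, $\alpha\in\mathcal{D}(\beta)$, of maximal dimension. Set $\mathcal{I}=\bigcup_\beta\mathcal{C}(\beta)$, the union over all Schur roots $\beta$ of $Q$, and for $\alpha\in\mathbb{Q}^{Q_0}$ set $\mathcal{I}_\alpha=\{\mathcal{C}\in\mathcal{I}\mid\alpha\in\mathcal{C}\}$. *)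

(* Defs.v *)
From mathcomp Require Import all_boot all_order all_algebra.
From mathcomp Require Import boolp classical_sets.

Set Implicit Arguments.
Unset Strict Implicit.
Unset Printing Implicit Defensive.

Import Order.TTheory GRing.Theory Num.Theory.
Local Open Scope classical_set_scope.
Local Open Scope ring_scope.

Record quiver := Quiver {
  vert : finType;
  arr : finType;
  tl : arr -> vert;
  hd : arr -> vert
}.

Definition adjacent (Q : quiver) : rel (vert Q) :=
  fun x y => [exists a : arr Q,
    ((tl a == x) && (hd a == y)) || ((tl a == y) && (hd a == x))].

Definition connected_quiver (Q : quiver) : Prop :=
  forall x y : vert Q, connect (@adjacent Q) x y.

(* [cycle e [:: a1; ...; an]] says [e a1 a2], ..., [e an a1]; for n = 1 this is
   a loop. It holds vacuously of the empty sequence. *)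
Definition acyclic_quiver (Q : quiver) : Prop :=
  forall s : seq (arr Q), cycle (fun a b => hd a == tl b) s -> s = [::].

(* [rat^o] is [rat] seen as a vector space over itself; with it the type below
   is a [vectType rat]. *)
Definition qvec (Q : quiver) := {ffun vert Q -> rat^o}.

Definition dimvec (Q : quiver) := {ffun vert Q -> nat}.

Definition qvec_of_dim (Q : quiver) (b : dimvec Q) : qvec Q :=
  [ffun x => (b x)%:R].

Definition unit_vec (Q : quiver) (x : vert Q) : qvec Q :=
  [ffun y => (y == x)%:R].

Definition euler (Q : quiver) (u v : qvec Q) : rat :=
  \sum_(x : vert Q) u x * v x - \sum_(a : arr Q) u (tl a) * v (hd a).

Definition weight_at (Q : quiver) (theta b : qvec Q) : rat :=
  \sum_(x : vert Q) theta x * b x.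

Definition wt (Q : quiver) (alpha : qvec Q) : qvec Q :=
  [ffun x => euler alpha (unit_vec x)].

Record rep (K : fieldType) (Q : quiver) := Rep {
  rspace : vert Q -> vectType K;
  rmap : forall a : arr Q, 'Hom(rspace (tl a), rspace (hd a))
}.

Section Representations.
Variables (K : fieldType) (Q : quiver).
Implicit Types (V : rep K Q) (beta : dimvec Q) (alpha theta : qvec Q).

Definition rdim V : dimvec Q := [ffun x => \dim {:rspace V x}].

Definition subrep V (W : forall x, {vspace rspace V x}) : Prop :=
  forall a : arr Q, (rmap V a @: W (tl a) <= W (hd a))%VS.

Definition subdim V (W : forall x, {vspace rspace V x}) : dimvec Q :=
  [ffun x => \dim (W x)].

Definition semistable theta V : Prop :=
  weight_at theta (qvec_of_dim (rdim V)) = 0 /\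
  forall W : forall x, {vspace rspace V x},
    subrep W -> weight_at theta (qvec_of_dim (subdim W)) <= 0.

(* Classes of representations are bare predicates: [rep K Q] lives in too large
   a universe for [set (rep K Q)]. A full subcategory is given by its class of
   objects. *)
Definition rep_ss theta : rep K Q -> Prop := semistable theta.

Definition rep_dim_ss beta theta : rep K Q -> Prop :=
  fun V => rdim V = beta /\ semistable theta V.

Definition endomorphism V (phi : forall x, 'End(rspace V x)) : Prop :=
  forall a : arr Q,
    (phi (hd a) \o rmap V a)%VF = (rmap V a \o phi (tl a))%VF.

(* [f] is an isomorphism of K-algebras from K onto End_Q(V), viewed inside the
   product of the algebras End(V x). *)
Definition End_iso_K V : Prop :=
  exists f : K -> forall x, 'End(rspace V x),
    [/\ forall c, endomorphism (f c),
        forall c d, (forall x, f c x = f d x) -> c = d,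
        forall phi : (forall x, 'End(rspace V x)), endomorphism phi ->
          exists c, forall x, f c x = phi x,
        forall k c d x, f (k * c + d) x = k *: f c x + f d x &
        (forall x, f 1 x = \1%VF) /\
        (forall c d x, f (c * d) x = (f c x \o f d x)%VF)].

Definition Schur_root beta : Prop :=
  exists V, rdim V = beta /\ End_iso_K V.

Definition Dcone beta : set (qvec Q) :=
  [set alpha | exists V, rep_dim_ss beta (wt alpha) V].

Definition GIT_cone beta alpha : set (qvec Q) :=
  [set alpha' | Dcone beta alpha' /\
     forall V, rep_dim_ss beta (wt alpha) V -> rep_dim_ss beta (wt alpha') V].

(* The dimension of a cone is that of its linear span, the least subspace
   containing it. *)
Definition has_dim (S : set (qvec Q)) (d : nat) : Prop :=
  exists U : {vspace qvec Q},
    [/\ forall v, S v -> v \in U,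
        forall W : {vspace qvec Q}, (forall v, S v -> v \in W) -> (U <= W)%VS
      & \dim U = d].

(* The GIT-cones of beta whose dimension is the largest among all of them. *)
Definition max_GIT_cones beta : set (set (qvec Q)) :=
  [set C | exists alpha, [/\ Dcone beta alpha, C = GIT_cone beta alpha &
     exists d, has_dim C d /\
       forall alpha' d', Dcone beta alpha' ->
         has_dim (GIT_cone beta alpha') d' -> (d' <= d)%N]].

Definition GIT_system : set (set (qvec Q)) :=
  \bigcup_(beta in [set beta | Schur_root beta]) max_GIT_cones beta.

Definition GIT_system_at alpha : set (set (qvec Q)) :=
  [set C | GIT_system C /\ C alpha].

Definition GIT_equivalent alpha1 alpha2 : Prop :=
  forall V, rep_ss (wt alpha1) V <-> rep_ss (wt alpha2) V.

End Representations.

Arguments GIT_equivalent K {Q} alpha1 alpha2.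
Arguments GIT_system_at K {Q} alpha _.

(* Main.v *)
Require Import Defs.
From HB Require Import structures.
From mathcomp Require Import all_boot all_order all_algebra.
From mathcomp Require Import boolp classical_sets.

Set Implicit Arguments.
Unset Strict Implicit.
Unset Printing Implicit Defensive.

Import Order.TTheory GRing.Theory Num.Theory.
Local Open Scope ring_scope.

(** Why the theorem holds.  If the two weights have the same semistable
representations, every GIT-cone that contains one vector contains the other,
straight from the definition of GIT-cones.  The content is the converse.

Assume that every cone of the system through [a] also contains [a'].  A
semistable representation is an iterated extension of stable ones, and
semistability for the weight of [a'] is inherited by extensions, so it
suffices to show that a representation [V] that is stable for the weight of [a]
is semistable for the weight of [a'] ([semistable_via_stable]).  By Schur's lemma
the dimension vector [b] of [V] is a Schur root ([stable_End_iso_K]).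

Semistability in dimension [b] is governed by the signs of the finitely many
forms [<_, c>] with [c <= b] on the hyperplane [H = {x | <x, b> = 0}].  Perturb
[a] inside [H] to a vector [g] so close to [a] that no nonzero sign changes, and
so general that none of these forms vanishes at [g] unless it vanishes on all of
[H] ([exists_generic_near]).  Then:
- [V] is still semistable at [g], because stability makes all inequalities for
  its proper nonzero subrepresentations strict;
- whatever is semistable at [g] in dimension [b] is semistable at [a], since
  semistability is a closed condition; so [a] lies in the GIT-cone of [g];
- the GIT-cone of [g] contains a neighbourhood of [g] in [H], so it spans [H],
  which contains every GIT-cone of [b]; so it has maximal dimension.
Thus the GIT-cone of [g] is a member of the system through [a]
([stable_in_max_GIT_cone]).  By assumption it contains [a'], and since [V] is
semistable at [g], it is semistable at [a'] too. *)

(** * Generic perturbation inside a subspace *)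

Section Perturbation.
Variables (F : realFieldType) (E : vectType F).
Implicit Types (l : 'Hom(E, F^o)) (s : seq 'Hom(E, F^o)) (a v : E).

Lemma small_step_keeps_signs s a v :
  exists2 t : F, 0 < t & forall u, 0 < u <= t ->
    forall l, l \in s -> l a != 0 -> 0 < (l a : F) * l (a + u *: v).
Proof.
elim: s => [|l s [t t0 IH]]; first by exists 1.
have [la0|la0] := eqVneq (l a) 0.
  exists t => // u ut l'; rewrite in_cons => /orP[/eqP->|]; last exact: IH.
  by rewrite la0 eqxx.
(* The step is bounded by [x^2 / (|x y| + 1)], so that [u |x y| < x^2]; the
   summand 1 makes this strict and avoids a division by zero. *)
pose x : F := l a; pose y : F := l v.
have den0 : 0 < `|x * y| + 1 by rewrite ltr_wpDl.
have x2 : 0 < x ^+ 2 by rewrite exprn_even_gt0 //= orbC la0.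
exists (Num.min t (x ^+ 2 / (`|x * y| + 1))).
  by rewrite lt_min t0 divr_gt0.
move=> u /andP[u0]; rewrite le_min => /andP[ut uy] l'.
rewrite in_cons => /orP[/eqP->|l's]; last by apply: IH l's; rewrite u0.
move=> _; rewrite linearD linearZ /= -/x -/y mulrDr -expr2 mulrCA.
rewrite -ltrBlDr sub0r ltrNl.
move: uy; rewrite ler_pdivlMr // => uy.
have xy : - (u * (x * y)) <= u * `|x * y|.
  by rewrite -mulrN ler_pM2l // -normrN ler_norm.
by rewrite ltrNl (le_lt_trans xy) // (lt_le_trans _ uy) // ltr_pM2l // ltrDl.
Qed.

(** A finite union of proper subspaces does not exhaust a vector space over an
    infinite field: a vector good for the forms in [s] that lies in the kernel
    of the next form is moved off it by a step too small to spoil the others. *)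
Lemma generic_vector (H : {vspace E}) s :
  exists2 v, v \in H & forall l, l \in s -> l v = 0 -> (H <= lker l)%VS.
Proof.
elim: s => [|l s [v vH IH]]; first by exists 0; rewrite ?mem0v.
have [lH|/subvPn[w wH]] := boolP (H <= lker l)%VS.
  by exists v => // l'; rewrite in_cons => /orP[/eqP->|/IH].
rewrite memv_ker => lw.
have [lv|lv] := eqVneq (l v) 0; last first.
  exists v => // l'; rewrite in_cons => /orP[/eqP->|/IH //].
  by move=> lv0; rewrite lv0 eqxx in lv.
have [t t0 small] := small_step_keeps_signs s v w.
exists (v + t *: w); first by rewrite memvD // memvZ.
move=> l'; rewrite in_cons => /orP[/eqP->|l's].
  rewrite linearD linearZ /= lv add0r => /eqP.
  by rewrite scaler_eq0 (negPf lw) gt_eqF.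
move=> l'0; apply: IH => //; apply/eqP; apply: contraT => l'v.
by have := small t; rewrite t0 lexx => /(_ isT l' l's l'v); rewrite l'0 mulr0 ltxx.
Qed.

(** A small step from [a] in the direction of a generic vector: it preserves
    the signs of the forms that are nonzero at [a], and a form that vanishes
    at [a] takes on the value of the generic direction, up to scaling. *)
Lemma generic_perturbation (H : {vspace E}) s a : a \in H ->
  exists2 b, b \in H & forall l, l \in s ->
    (l a != 0 -> 0 < (l a : F) * l b) /\ (l b = 0 -> (H <= lker l)%VS).
Proof.
move=> aH; have [v vH gen] := generic_vector H s.
have [t t0 small] := small_step_keeps_signs s a v.
exists (a + t *: v); first by rewrite memvD // memvZ.
move=> l ls; split=> [la|lb]; first by apply: small => //; rewrite t0 /=.
apply: gen => //; have [la|la] := eqVneq (l a) 0.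
  move/eqP: lb; rewrite linearD linearZ /= la add0r scaler_eq0 gt_eqF //=.
  by move/eqP.
by have := small t; rewrite t0 lexx => /(_ isT l ls la); rewrite lb mulr0 ltxx.
Qed.

End Perturbation.

(** * Subrepresentations, quotients and short exact sequences *)

Section Representations.
Variables (K : fieldType) (Q : quiver).
Implicit Types (A B V W : rep K Q) (theta : qvec Q) (b c d : dimvec Q).

Definition dim_weight theta b : rat := weight_at theta (qvec_of_dim b).

Lemma dim_weightE theta b : dim_weight theta b = \sum_x theta x * (b x)%:R.
Proof. by apply: eq_bigr => x _; rewrite ffunE. Qed.

Lemma dim_weightD theta b c d : (forall x, b x = c x + d x)%N ->
  dim_weight theta b = dim_weight theta c + dim_weight theta d.
Proof.
move=> e; rewrite !dim_weightE -big_split; apply: eq_bigr => x _.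
by rewrite e natrD mulrDr.
Qed.

Lemma dim_weight0 theta b : (forall x, b x = 0%N) -> dim_weight theta b = 0.
Proof. by move=> e; rewrite dim_weightE big1 // => x _; rewrite e mulr0. Qed.

Lemma eq_dim_weight theta b c : b =1 c -> dim_weight theta b = dim_weight theta c.
Proof. by move=> /ffunP->. Qed.

Lemma subrepP V (W : forall x, {vspace rspace V x}) :
  subrep W <-> forall a v, v \in W (tl a) -> rmap V a v \in W (hd a).
Proof.
split=> [sW a v vW|sW a]; first by apply/(subvP (sW a))/memv_img.
by apply/subvP => _ /memv_imgP[v /sW vW ->].
Qed.

Definition morphism V W (f : forall x, 'Hom(rspace V x, rspace W x)) : Prop :=
  forall a v, f (hd a) (rmap V a v) = rmap W a (f (tl a) v).

Section Morphism.
Variables (V W : rep K Q) (f : forall x, 'Hom(rspace V x, rspace W x)).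
Hypothesis f_mor : morphism f.

Lemma subrep_img (U : forall x, {vspace rspace V x}) :
  subrep U -> subrep (fun x => f x @: U x)%VS.
Proof.
move=> /subrepP sU; apply/subrepP => a _ /memv_imgP[v vU ->].
by rewrite -f_mor memv_img // sU.
Qed.

Lemma subrep_preim (U : forall x, {vspace rspace W x}) :
  subrep U -> subrep (fun x => f x @^-1: U x)%VS.
Proof.
by move=> /subrepP sU; apply/subrepP => a v; rewrite -!memv_preim f_mor => /sU.
Qed.

Lemma subrep_ker : subrep (fun x => lker (f x)).
Proof.
by apply/subrepP => a v; rewrite !memv_ker f_mor => /eqP->; rewrite linear0.
Qed.

End Morphism.

Lemma subrep_full V : subrep (fun x => {: rspace V x}%VS).
Proof. by move=> a; apply: subvf. Qed.

Definition short_exact A V B (i : forall x, 'Hom(rspace A x, rspace V x))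
    (p : forall x, 'Hom(rspace V x, rspace B x)) : Prop :=
  [/\ morphism i, morphism p, forall x, lker (i x) = 0%VS,
      forall x, limg (p x) = fullv & forall x, limg (i x) = lker (p x)].

Section ShortExact.
Variables (A V B : rep K Q) (i : forall x, 'Hom(rspace A x, rspace V x)).
Variables (p : forall x, 'Hom(rspace V x, rspace B x)) (theta : qvec Q).
Hypothesis ex : short_exact i p.

(** A subspace [U] of the middle term is an extension of its image by its
    intersection with the left term; applied to subrepresentations this reduces
    the middle term of an exact sequence to the outer ones. *)
Lemma dim_sub_exact (U : forall x, {vspace rspace V x}) x :
  (\dim (U x) = \dim (i x @^-1: U x) + \dim (p x @: U x))%N.
Proof.
case: ex => _ _ ki _ ei; rewrite -(limg_ker_dim (p x) (U x)) -ei.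
rewrite -lpreim_cap_limg -[X in (X + _)%N = _](congr1 _ (lpreimK (capvSr _ _))).
by rewrite limg_dim_eq // ki capv0.
Qed.

Lemma rdim_exact x : rdim V x = (rdim A x + rdim B x)%N.
Proof.
case: ex => _ _ ki sp ei; rewrite !ffunE (dim_sub_exact (fun x => fullv)) sp.
by congr (\dim _ + _)%N; apply/vspaceP => v; rewrite -memv_preim !memvf.
Qed.

Lemma semistable_ext :
  semistable theta A -> semistable theta B -> semistable theta V.
Proof.
case: ex => mi mp _ _ _ [A0 sA] [B0 sB]; split.
  by rewrite -/(dim_weight _ _) (dim_weightD _ rdim_exact) /dim_weight A0 B0 addr0.
move=> U sU; rewrite -/(dim_weight _ _).
rewrite (@dim_weightD _ _ (subdim (fun x => i x @^-1: U x)%VS)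
                          (subdim (fun x => p x @: U x)%VS)).
  have sA' := sA _ (subrep_preim mi sU); have sB' := sB _ (subrep_img mp sU).
  by rewrite -[0]addr0 lerD.
by move=> x; rewrite !ffunE; apply: dim_sub_exact.
Qed.

(** Weight zero of [A] is what makes the weights of a subrepresentation of
    [B] and of its preimage in [V] agree. *)
Lemma semistable_sub_quot : semistable theta V -> dim_weight theta (rdim A) = 0 ->
  semistable theta A /\ semistable theta B.
Proof.
case: ex => mi mp ki sp ei [V0 sV] A0.
split; split=> //.
- move=> U sU; have := sV _ (subrep_img mi sU); congr (_ <= 0).
  by apply: eq_dim_weight => x; rewrite !ffunE limg_dim_eq // ki capv0.
- by move: V0; rewrite -!/(dim_weight _ _) (dim_weightD _ rdim_exact) A0 add0r.
move=> U sU; have := sV _ (subrep_preim mp sU); rewrite -!/(dim_weight _ _).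
rewrite (@dim_weightD _ _ (rdim A) (subdim U)) ?A0 ?add0r // => x.
rewrite !ffunE -(limg_ker_dim (p x)) lpreimK ?sp ?subvf //; congr addn.
rewrite (capv_idPr _) -?ei; last by rewrite ei -lpreim0 lpreimS ?sub0v.
by rewrite limg_dim_eq // ki capv0.
Qed.

End ShortExact.

Section SubQuotient.
Variables (V : rep K Q) (W : forall x, {vspace rspace V x}).
Hypothesis sW : subrep W.

Definition sub_rep : rep K Q :=
  @Rep K Q (fun x => subvs_of (W x)) (fun a =>
    linfun (vsproj (W (hd a))) \o rmap V a \o linfun vsval)%VF.

(** The quotient [V / W] is modelled on the image of the projection that kills
    [W]; a preimage of a class is unique only up to [W], which [subrep W]
    makes harmless. *)
Definition coset_proj x : 'End(rspace V x) := \1%VF - projv (W x).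

Definition quot_rep : rep K Q :=
  @Rep K Q (fun x => subvs_of (limg (coset_proj x))) (fun a =>
    linfun (vsproj (limg (coset_proj (hd a)))) \o coset_proj (hd a) \o
      rmap V a \o (coset_proj (tl a))^-1 \o linfun vsval)%VF.

Definition sub_incl x : 'Hom(rspace sub_rep x, rspace V x) := linfun vsval.

Definition quot_proj x : 'Hom(rspace V x, rspace quot_rep x) :=
  (linfun (vsproj (limg (coset_proj x))) \o coset_proj x)%VF.

Lemma lker_coset_proj x : lker (coset_proj x) = W x.
Proof.
apply/vspaceP => v; rewrite memv_ker add_lfunE opp_lfunE id_lfunE subr_eq0.
by apply/eqP/idP => [->|/projv_id->//]; apply: memv_proj.
Qed.

Lemma vsval_quot_proj x v : vsval (quot_proj x v) = coset_proj x v.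
Proof.
by rewrite comp_lfunE lfunE /= vsprojK // memv_img // memvf.
Qed.

Lemma vsval_quot_rmap a u : vsval (rmap quot_rep a u) =
  coset_proj (hd a) (rmap V a ((coset_proj (tl a))^-1%VF (vsval u))).
Proof.
by rewrite !comp_lfunE lfunE /= (lfunE vsval) vsprojK // memv_img // memvf.
Qed.

Lemma short_exact_sub_quot : short_exact sub_incl quot_proj.
Proof.
split.
- move=> a v; rewrite /sub_incl !comp_lfunE !lfunE /= vsprojK //.
  by apply: (subvP (sW a)); rewrite memv_img // subvsP.
- move=> a v; apply: subvs_inj; rewrite vsval_quot_proj.
  rewrite vsval_quot_rmap vsval_quot_proj.
  set f := coset_proj (tl a); apply/esym/eqP; rewrite -subr_eq0 -!linearB /=.
  rewrite -memv_ker lker_coset_proj; apply: (subvP (sW a)); rewrite memv_img //.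
  by rewrite -lker_coset_proj memv_ker linearB /= limg_lfunVK ?subrr ?memv_img ?memvf.
- move=> x; apply/eqP/lker0P => u v; rewrite !lfunE; apply: subvs_inj.
- move=> x; apply/vspaceP => u; rewrite memvf; apply/memv_imgP.
  have /memv_imgP[v _ e] := subvsP u.
  by exists v; rewrite ?memvf //; apply: subvs_inj; rewrite vsval_quot_proj.
move=> x; apply/vspaceP => v; apply/memv_imgP/idP => [[u _ ->]|].
  rewrite memv_ker -(inj_eq subvs_inj) vsval_quot_proj -memv_ker.
  by rewrite lker_coset_proj lfunE /= subvsP.
rewrite memv_ker -(inj_eq subvs_inj) vsval_quot_proj -memv_ker.
rewrite lker_coset_proj => vW; exists (vsproj (W x) v); rewrite ?memvf //.
by rewrite lfunE /= vsprojK.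
Qed.

Lemma rdim_sub_rep : rdim sub_rep = subdim W.
Proof. by apply/ffunP => x; rewrite !ffunE dimvf /dim. Qed.

End SubQuotient.

(** * Stable representations *)

Definition stable theta V : Prop :=
  [/\ semistable theta V, exists x, {: rspace V x}%VS != 0%VS &
      forall W : forall x, {vspace rspace V x}, subrep W ->
        dim_weight theta (subdim W) = 0 ->
        (forall x, W x = 0%VS) \/ (forall x, W x = fullv)].

Lemma semistable0 theta V : (forall x, {: rspace V x}%VS = 0%VS) -> semistable theta V.
Proof.
move=> V0; split=> [|W _]; rewrite -/(dim_weight _ _) dim_weight0 // => x.
  by rewrite ffunE V0 dimv0.
by rewrite ffunE; apply/eqP; rewrite dimv_eq0 -subv0 -V0 subvf.
Qed.

(** The Jordan-Hoelder filtration, as an induction on the total dimension: a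
    representation that is neither zero nor stable has a proper nonzero
    subrepresentation of weight zero, and it is semistable as soon as that
    subrepresentation and its quotient are. *)
Lemma semistable_via_stable theta theta' :
  (forall V, stable theta V -> semistable theta' V) ->
  forall V, semistable theta V -> semistable theta' V.
Proof.
move=> st V; have [n] := ubnP (\sum_x rdim V x)%N.
elim: n V => // n IH V lt_n ssV.
have [V0|/existsNP[x /eqP Vx]] := pselect (forall x, {: rspace V x}%VS = 0%VS).
  exact: semistable0.
have [stV|] := pselect (stable theta V); first exact: st.
move=> /not_and3P[//|[]|]; first by exists x.
move=> /existsNP[W /not_implyP[sW /not_implyP[W0 /not_orP[]]]].
move=> /existsNP[y /eqP Wy] /existsNP[z /eqP Wz].
have ex := short_exact_sub_quot sW.
have dimV : (\sum_x rdim V x = \sum_x rdim (sub_rep W) x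
             + \sum_x rdim (quot_rep W) x)%N.
  by rewrite -big_split; apply: eq_bigr => u _; apply: rdim_exact ex _.
have [||sA sB] := semistable_sub_quot ex (theta := theta) => //.
  by rewrite rdim_sub_rep.
apply: (semistable_ext ex); apply: IH => //; move: lt_n; rewrite ltnS dimV;
  apply: leq_trans.
- rewrite -addn1 leq_add2l (bigD1 z) //= ltn_addr //.
  have := rdim_exact ex z; rewrite rdim_sub_rep !ffunE => e.
  have := dimv_leqif_eq (subvf (W z)) => /ltn_leqif.
  by rewrite Wz e -{1}[\dim (W z)]addn0 ltn_add2l.
rewrite -add1n leq_add2r (bigD1 y) //= ltn_addr //.
by rewrite rdim_sub_rep ffunE lt0n dimv_eq0.
Qed.

End Representations.

(** * Schur's lemma *)

Import passmx.

Section Schur.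
Let end_simp := (comp_lfunE, scale_lfunE, opp_lfunE, add_lfunE, id_lfunE).
Variables (K : closedFieldType) (Q : quiver).

Lemma exists_eigenvalue (E : vectType K) (f : 'End(E)) : {: E}%VS != 0%VS ->
  exists c, lker (f - c *: \1%VF) != 0%VS.
Proof.
move=> E0; pose e := vbasis {: E}; have be := vbasisP {: E}.
have [c] : exists c, root (char_poly (mxof e e f)) c.
  by apply/closed_rootP; rewrite size_char_poly eqSS dimv_eq0.
rewrite -eigenvalue_root_char => /eigenvalueP[u]; rewrite mul_mxof => eu u0.
exists c; apply: contra_neq u0 => k0; apply/eqP.
rewrite -(vecof_eq0 be) -memv0 -k0 memv_ker !end_simp subr_eq0.
by rewrite -[f _](rVofK be) eu linearZ.
Qed.

(** For an eigenvalue [c] of an endomorphism [phi] at a vertex with a nonzero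
    space, [phi - c] has a nonzero kernel.  The weights of its kernel and image
    are nonpositive and sum to zero, so the kernel has weight zero, and by
    stability it is everything: [phi = c]. *)
Lemma stable_End_iso_K theta (V : rep K Q) : stable theta V -> End_iso_K V.
Proof.
move=> [[V0 ssV] [y Vy] st]; exists (fun c x => c *: \1%VF); split.
- by move=> c a; apply/lfunP => v; rewrite !end_simp /= linearZ.
- move=> c d /(_ y) /lfunP /(_ (vpick fullv)); rewrite !end_simp => /eqP.
  by rewrite -subr_eq0 -scalerBl scaler_eq0 vpick0 (negPf Vy) orbF subr_eq0 => /eqP.
- move=> phi ephi; have [c kc] := exists_eigenvalue (phi y) Vy.
  pose psi x : 'End(rspace V x) := phi x - c *: \1%VF.
  have mpsi : morphism psi.
    move=> a v; rewrite /psi !end_simp linearB /=.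
    rewrite [rmap V a (c *: v)]linearZ /=; congr (_ - _).
    by have /lfunP/(_ v) := ephi a; rewrite !end_simp.
  have sk := subrep_ker mpsi; have si := subrep_img mpsi (@subrep_full _ _ V).
  have k0 : dim_weight theta (subdim (fun x => lker (psi x))) = 0.
    apply/le_anti; rewrite ssV //=.
    have := V0; rewrite -/(dim_weight _ _) (@dim_weightD _ _ _
      (subdim (fun x => lker (psi x))) (subdim (fun x => limg (psi x)))).
      by move/eqP; rewrite addr_eq0 => /eqP->; rewrite oppr_ge0 ssV.
    by move=> x; rewrite !ffunE -(limg_ker_dim (psi x)) capfv.
  have [k|k] := st _ sk k0; first by rewrite -[lker _]/(lker (psi y)) k eqxx in kc.
  exists c => x; apply/lfunP => v; apply/esym/eqP; rewrite -subr_eq0.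
  by have := memvf v; rewrite -(k x) memv_ker !end_simp.
- by move=> k c d x; apply/lfunP => v; rewrite !end_simp scalerDl scalerA.
by split=> [x|c d x]; apply/lfunP => v; rewrite !end_simp ?scale1r ?scalerA.
Qed.

End Schur.

(** * GIT-cones of generic vectors *)

Section Cones.
Variables (K : fieldType) (Q : quiver).
Implicit Types (V : rep K Q) (b : dimvec Q).

Definition wt_pairing b (alpha : qvec Q) : rat^o := dim_weight (wt alpha) b.

Lemma wt_pairing_is_linear b : linear (wt_pairing b).
Proof.
move=> k u v; rewrite /wt_pairing.
change (dim_weight (wt (k *: u + v)) b =
        k * dim_weight (wt u) b + dim_weight (wt v) b).
rewrite !dim_weightE mulr_sumr -big_split /=; apply: eq_bigr => x _.
rewrite mulrA -mulrDl; congr (_ * _).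
rewrite !ffunE /euler mulrBr addrACA -opprD !mulr_sumr -!big_split /=.
by congr (_ - _); apply: eq_bigr => y _; rewrite !ffunE mulrDl mulrA.
Qed.

HB.instance Definition _ b :=
  GRing.isLinear.Build rat (qvec Q) rat^o _ (wt_pairing b) (wt_pairing_is_linear b).

Definition wt_form b : 'Hom(qvec Q, rat^o) := linfun (wt_pairing b).

Lemma wt_formE b alpha : wt_form b alpha = dim_weight (wt alpha) b.
Proof. exact: lfunE. Qed.

Lemma finitely_many_subdims b : exists s : seq (dimvec Q),
  forall c : dimvec Q, (forall x, c x <= b x)%N -> c \in s.
Proof.
pose m := (\sum_x b x)%N.
exists [seq [ffun x => val (g x)] | g : {ffun vert Q -> 'I_m.+1}] => c cb.
apply/mapP; exists [ffun x => inord (c x)]; first by rewrite mem_enum.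
apply/ffunP => x; rewrite !ffunE /= inordK // ltnS (leq_trans (cb x)) //.
by rewrite /m (bigD1 x) //= leq_addr.
Qed.

Lemma subdim_le V (W : forall x, {vspace rspace V x}) x :
  (subdim W x <= rdim V x)%N.
Proof. by rewrite !ffunE dimvS ?subvf. Qed.

(** The hyperplane of vectors orthogonal to [b], or the whole space if the
    pairing with [b] is zero. *)
Definition orth b : {vspace qvec Q} := lker (wt_form b).

Lemma orthP b alpha V : alpha \in orth b -> rdim V = b ->
  weight_at (wt alpha) (qvec_of_dim (rdim V)) = 0.
Proof. by rewrite memv_ker wt_formE => /eqP + ->. Qed.

Lemma Dcone_sub b alpha : Dcone K b alpha -> alpha \in orth b.
Proof. by move=> [V [<- [V0 _]]]; rewrite memv_ker wt_formE; apply/eqP. Qed.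

(** Two vectors of [orth b] define the same semistable representations of
    dimension [b] if the forms [wt_form c] with [c <= b] have the same signs at
    both.  This says that [g] refines the signs at [alpha] without
    changing the nonzero ones, and lies in an open cell of the arrangement cut
    out on [orth b] by these forms. *)
Definition generic_near b alpha g : Prop :=
  g \in orth b /\ forall c : dimvec Q, (forall x, c x <= b x)%N ->
    (wt_form c alpha != 0 -> 0 < (wt_form c alpha : rat) * wt_form c g) /\
    (wt_form c g = 0 -> (orth b <= lker (wt_form c))%VS).

Lemma exists_generic_near b alpha :
  alpha \in orth b -> exists g, generic_near b alpha g.
Proof.
move=> aH; have [ds dsP] := finitely_many_subdims b.
have [g gH gP] := generic_perturbation [seq wt_form c | c <- ds] aH.
by exists g; split=> // c cb; apply/gP/map_f/dsP.
Qed.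

(** Stability is an open condition: the inequalities that are strict at [alpha]
    persist, and the others belong to the zero and the full subrepresentation,
    whose weights vanish on all of [orth]. *)
Lemma stable_generic_near alpha g V : generic_near (rdim V) alpha g ->
  stable (wt alpha) V -> semistable (wt g) V.
Proof.
move=> [gH gP] [ssV _ st]; have gV := orthP gH erefl.
split=> // W sW; have [gp _] := gP _ (subdim_le W); move: gp.
rewrite !wt_formE; have := ssV.2 W sW.
rewrite -!/(dim_weight _ _) le_eqVlt => /orP[/eqP W0|Wlt].
  have [Wz|Wf] := st W sW W0.
    by rewrite [X in X <= _]dim_weight0 // => x; rewrite ffunE Wz dimv0.
  have -> : subdim W = rdim V by apply/ffunP => x; rewrite !ffunE Wf.
  by rewrite /dim_weight gV.
by rewrite lt_eqF // => /(_ isT); rewrite nmulr_rgt0 // => /ltW.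
Qed.

(** Semistability is a closed condition: a subrepresentation of positive weight
    at [alpha] would still have positive weight at [g]. *)
Lemma GIT_cone_generic_near b alpha g : generic_near b alpha g ->
  Dcone K b alpha -> GIT_cone K b g alpha.
Proof.
move=> [gH gP] Da; split=> // U [Ub [_ ssU]]; split=> //.
split=> [|X sX]; first exact: orthP (Dcone_sub Da) Ub.
have Xb x : (subdim X x <= b x)%N by rewrite -Ub subdim_le.
have := ssU X sX; rewrite -!/(dim_weight _ _) -!wt_formE leNgt => gX.
rewrite leNgt; apply: contra gX => aX.
by have := (gP _ Xb).1; rewrite gt_eqF // => /(_ isT); rewrite pmulr_rgt0.
Qed.

(** A short step from [g] in any direction [h] of [orth b] stays in the cone:
    nonzero signs persist, and the forms that vanish at [g] vanish on
    [orth b].  So the span of the cone contains [h]. *)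
Lemma GIT_cone_generic_dim b alpha g : generic_near b alpha g ->
  Dcone K b g -> has_dim (GIT_cone K b g) (\dim (orth b)).
Proof.
move=> [gH gP] Dg; exists (orth b); split=> [v [/Dcone_sub //]|W CW|//].
apply/subvP => h hH; have [ds dsP] := finitely_many_subdims b.
have [t t0 small] := small_step_keeps_signs [seq wt_form c | c <- ds] g h.
have gthH : g + t *: h \in orth b by rewrite memvD // memvZ.
have gW : g \in W by apply: CW.
have gthW : g + t *: h \in W.
  suff ss_t (U : rep K Q) : rep_dim_ss b (wt g) U ->
      rep_dim_ss b (wt (g + t *: h)) U.
    by apply: CW; split=> //; have [V /ss_t] := Dg; exists V.
  move=> [Ub [U0 ssU]]; split=> //; split=> [|X sX]; first exact: orthP gthH Ub.
  have Xb x : (subdim X x <= b x)%N by rewrite -Ub subdim_le.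
  have := ssU X sX; rewrite -!/(dim_weight _ _) -!wt_formE.
  rewrite le_eqVlt => /orP[/eqP X0|Xlt].
    have /subvP/(_ _ gthH) := (gP _ Xb).2 X0.
    by rewrite memv_ker => /eqP->.
  have := small t; rewrite t0 lexx => /(_ isT _ (map_f _ (dsP _ Xb))).
  by rewrite lt_eqF // => /(_ isT); rewrite nmulr_rgt0 // => /ltW.
have : t *: h \in W by rewrite -(addKr g (t *: h)) addrC memvB.
by move=> /(memvZ t^-1); rewrite scalerA mulVf ?scale1r // gt_eqF.
Qed.

(** The GIT-cone of [alpha] itself need not have maximal dimension; that of a
    generic vector near [alpha] does, and still sees [alpha] and [V]. *)
Lemma stable_in_max_GIT_cone alpha V : stable (wt alpha) V ->
  exists C, [/\ max_GIT_cones K (rdim V) C, C alpha &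
    forall alpha', C alpha' -> semistable (wt alpha') V].
Proof.
move=> stV; have Da : Dcone K (rdim V) alpha by case: stV => ssV _ _; exists V.
have [g gP] := exists_generic_near (Dcone_sub Da).
have gV := stable_generic_near gP stV.
have Dg : Dcone K (rdim V) g by exists V.
exists (GIT_cone K (rdim V) g); split; last by move=> alpha' [_ /(_ V)[]].
  exists g; split=> //; exists (\dim (orth (rdim V))).
  split=> [|alpha' d' _ [U [_ Umin <-]]]; first exact: GIT_cone_generic_dim gP Dg.
  by apply/dimvS/Umin => v [/Dcone_sub].
exact: GIT_cone_generic_near gP Da.
Qed.

End Cones.

(** * GIT-equivalence *)

Theorem theorem1 (K : closedFieldType) (charK : [pchar K] =i pred0)
    (Q : quiver) (Qconn : connected_quiver Q) (Qacyc : acyclic_quiver Q)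
    (alpha1 alpha2 : qvec Q) :
  GIT_equivalent K alpha1 alpha2 <->
  GIT_system_at K alpha1 = GIT_system_at K alpha2.
Proof.
have fwd (a a' : qvec Q) : GIT_equivalent K a a' ->
    (GIT_system_at K a `<=` GIT_system_at K a')%classic.
  move=> eqv C [sysC Ca]; split=> //.
  case: (sysC) => b _ [g [_ Cg _]]; move: Ca; rewrite Cg => -[[V [Vb ssV]] sub].
  split=> [|U /sub[Ub ssU]]; first by exists V; split=> //; apply/eqv.
  by split=> //; apply/eqv.
have bwd (a a' : qvec Q) : (GIT_system_at K a `<=` GIT_system_at K a')%classic ->
    forall V : rep K Q, semistable (wt a) V -> semistable (wt a') V.
  move=> sub; apply: semistable_via_stable => V stV.
  have [C [maxC Ca CV]] := stable_in_max_GIT_cone stV.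
  have [|_ Ca'] := sub C; last exact: CV.
  split=> //; exists (rdim V) => //.
  by exists V; split=> //; apply: stable_End_iso_K stV.
split=> [eqv|eqI V].
  by apply/seteqP; split; apply: fwd => // V; split=> /eqv.
by split; apply: bwd; rewrite eqI.
Qed.
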